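(* There exists a functor $\Phi:\mathbf{Grpd}\to\mathbf{PA}$ such that $\Psi\Phi\cong 1_{\mathbf{Grpd}}$. Furthermore, for every groupoid $\Gamma$, $\Phi(\Gamma)$ is the unique (up to isomorphism) partial action such that: (i) there exists a natural isomorphism of groupoids $\eta_\Gamma:\Psi(\Phi(\Gamma))\to\Gamma$, and (ii) if $\theta$ is a partial action and $f:\Gamma\to\Psi(\theta)$ is an isomorphism of groupoids, then there exists a unique morphism of partial actions $\phi:\Phi(\Gamma)\to\theta$ such that $\Psi(\phi)=f\circ\eta_\Gamma$; in particular $\Psi(\phi):\Psi(\Phi(\Gamma))\to\Psi(\theta)$ is an isomorphism of groupoids. (Uniqueness means: if $\theta'$ is a partial action with an isomorphism $\eta':\Psi(\theta')\to\Gamma$ such that (ii) holds with $(\theta',\eta')$ in place of $(\Phi(\Gamma),\eta_\Gamma)$, then $\theta'\cong\Phi(\Gamma)$ in $\mathbf{PA}$.) Moreover, $\Phi$ and $\Psi$ determine an adjunction between $\mathbf{PA}$ and $\mathbf{Grpd}$: for any partial action $\theta$ and any groupoid $\Gamma$ there is an isomorphism, natural in $\Gamma$ and $\theta$, $$\hom_{\mathbf{PA}}(\Phi(\Gamma),\theta)\cong\hom_{\mathbf{Grpd}}(\Gamma,\Psi(\theta)).$$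
   Context: Partial action: $\theta=(G,X,\{X_g\},\{\theta_g\})$ of a group $G$ on a set $X$ consists of subsets $X_g\subseteq X$ and bijections $\theta_g:X_{g^{-1}}\to X_g$ ($g\in G$) such that (i) $X_1=X$, $\theta_1=1_X$; (ii) $\theta_g(X_{g^{-1}}\cap X_{g^{-1}h})\subseteq X_g\cap X_h$; (iii) $\theta_g\theta_h(x)=\theta_{gh}(x)$ for $x\in X_{h^{-1}}\cap X_{h^{-1}g^{-1}}$. A morphism from $(G,X,\{X_g\},\{\alpha_g\})$ to $(S,Y,\{Y_s\},\{\beta_s\})$ is a pair $(\phi_0,\phi_1)$ with $\phi_0:X\to Y$ a map and $\phi_1:G\to S$ a group homomorphism such that $\phi_0(X_g)\subseteq Y_{\phi_1(g)}$ and $\phi_0(\alpha_g(x))=\beta_{\phi_1(g)}(\phi_0(x))$ for $x\in X_{g^{-1}}$. $\mathbf{PA}$ is the category of all partial actions (group and set both vary) with these morphisms. $\mathbf{Grpd}$ is the category of (small) groupoids and functors. Functor $\Psi:\mathbf{PA}\to\mathbf{Grpd}$ (partial action groupoid): for a partial action $\theta=(G,X,\{X_g\}_{g\in G},\{\theta_g\}_{g\in G})$ of a group $G$ on a set $X$, $\Psi(\theta)=\Gamma_\theta$ is the groupoid with object set $X$ and arrows $\{(\theta_g(x),g,x): g\in G,\ x\in X_{g^{-1}}\}$, where $(\theta_g(x),g,x)$ has source $x$ and target $\theta_g(x)$, composition $(\theta_g(y),g,y)(\theta_h(x),h,x)=(\theta_{gh}(x),gh,x)$ when $y=\theta_h(x)$,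 and units $(x,1,x)$. On morphisms, $\Psi(\phi)(y,g,x)=(\phi_0(y),\phi_1(g),\phi_0(x))$. *)

(* Defs.v *)
From HB Require Import structures.
From mathcomp Require Import all_boot.
From mathcomp Require Import boolp classical_sets.

Set Implicit Arguments.
Unset Strict Implicit.
Unset Printing Implicit Defensive.

Local Open Scope classical_set_scope.
Local Open Scope group_scope.

Declare Scope cat_scope.
Delimit Scope cat_scope with cat.
Local Open Scope cat_scope.

Record category := Category {
  cobj :> Type;
  hom : cobj -> cobj -> Type;
  idc : forall a, hom a a;
  ccomp : forall a b c, hom b c -> hom a b -> hom a c;
  ccompA : forall a b c d (h : hom c d) (g : hom b c) (f : hom a b),
    ccomp h (ccomp g f) = ccomp (ccomp h g) f;
  ccomp1f : forall a b (f : hom a b), ccomp (idc b) f = f;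
  ccompf1 : forall a b (f : hom a b), ccomp f (idc a) = f }.

Arguments hom {C} _ _ : rename.
Arguments idc {C} _ : rename.
Arguments ccomp {C a b c} _ _ : rename.

Notation "g \oc f" := (ccomp g f)
  (at level 50, left associativity) : cat_scope.

Definition is_iso (C : category) (a b : C) (f : hom a b) : Prop :=
  exists g : hom b a, g \oc f = idc a /\ f \oc g = idc b.

Definition isomorphic (C : category) (a b : C) : Prop :=
  exists f : hom a b, is_iso f.

Record functor (C D : category) := Functor {
  fobj :> C -> D;
  fmap : forall a b, hom a b -> hom (fobj a) (fobj b);
  fmap_id : forall a, fmap (idc a) = idc (fobj a);
  fmap_comp : forall a b c (g : hom b c) (f : hom a b),
    fmap (g \oc f) = fmap g \oc fmap f }.

Arguments fmap {C D} F {a b} _ : rename.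

Definition id_functor (C : category) : functor C C :=
  @Functor C C (fun a => a) (fun a b f => f)
    (fun=> erefl) (fun _ _ _ _ _ => erefl).

Section CompFunctor.
Variables (C D E : category) (G : functor D E) (F : functor C D).

Lemma comp_functor_id a : fmap G (fmap F (idc a)) = idc (G (F a)).
Proof. by rewrite !fmap_id. Qed.

Lemma comp_functor_comp a b c (g : hom b c) (f : hom a b) :
  fmap G (fmap F (g \oc f)) = fmap G (fmap F g) \oc fmap G (fmap F f).
Proof. by rewrite !fmap_comp. Qed.

Definition comp_functor : functor C E :=
  @Functor C E (fun a => G (F a)) (fun a b f => fmap G (fmap F f))
    comp_functor_id comp_functor_comp.

End CompFunctor.

Definition natural_isomorphism (C D : category) (F G : functor C D)
    (eta : forall a, hom (F a) (G a)) : Prop :=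
  (forall a b (f : hom a b), fmap G f \oc eta a = eta b \oc fmap F f) /\
  (forall a, is_iso (eta a)).

Arguments natural_isomorphism {C D} F G eta.

Definition adjoint (C D : category) (L : functor C D) (R : functor D C)
    : Prop :=
  exists tau : forall (a : C) (b : D), hom (L a) b -> hom a (R b),
    [/\ forall a b, bijective (tau a b),
        forall a a' b (k : hom a' a) (m : hom (L a) b),
          tau a' b (m \oc fmap L k) = tau a b m \oc k
      & forall a b b' (k : hom b b') (m : hom (L a) b),
          tau a b' (k \oc m) = fmap R k \oc tau a b m].

(* [gcomp g f] is the composite "g after f", defined only for composable
   arrows. *)
Record groupoid := Groupoid {
  gobj : Type;
  garr : Type;
  gsrc : garr -> gobj;
  gtgt : garr -> gobj;
  gid : gobj -> garr;
  ginv : garr -> garr;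
  gcomp : forall g f : garr, gsrc g = gtgt f -> garr;
  gsrc_id : forall x, gsrc (gid x) = x;
  gtgt_id : forall x, gtgt (gid x) = x;
  gsrc_inv : forall f, gsrc (ginv f) = gtgt f;
  gtgt_inv : forall f, gtgt (ginv f) = gsrc f;
  gsrc_comp : forall g f (e : gsrc g = gtgt f), gsrc (gcomp e) = gsrc f;
  gtgt_comp : forall g f (e : gsrc g = gtgt f), gtgt (gcomp e) = gtgt g;
  gcompA : forall h g f (e1 : gsrc h = gtgt g) (e2 : gsrc g = gtgt f)
      (e3 : gsrc h = gtgt (gcomp e2)) (e4 : gsrc (gcomp e1) = gtgt f),
    gcomp e3 = gcomp e4;
  gcomp1f : forall f (e : gsrc (gid (gtgt f)) = gtgt f), gcomp e = f;
  gcompf1 : forall f (e : gsrc f = gtgt (gid (gsrc f))), gcomp e = f;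
  gcompVf : forall f (e : gsrc (ginv f) = gtgt f), gcomp e = gid (gsrc f);
  gcompfV : forall f (e : gsrc f = gtgt (ginv f)), gcomp e = gid (gtgt f) }.

Record groupoid_functor (A B : groupoid) := GroupoidFunctor {
  gf_obj : gobj A -> gobj B;
  gf_arr : garr A -> garr B;
  gf_src : forall f, gsrc (gf_arr f) = gf_obj (gsrc f);
  gf_tgt : forall f, gtgt (gf_arr f) = gf_obj (gtgt f);
  gf_id : forall x, gf_arr (gid x) = gid (gf_obj x);
  gf_comp : forall g f (e : gsrc g = gtgt f)
      (e' : gsrc (gf_arr g) = gtgt (gf_arr f)),
    gf_arr (gcomp e) = gcomp e' }.

Lemma groupoid_functor_eq (A B : groupoid) (F G : groupoid_functor A B) :
  gf_obj F = gf_obj G -> gf_arr F = gf_arr G -> F = G.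
Proof.
case: F => o a p1 p2 p3 p4; case: G => o' a' q1 q2 q3 q4 /= eo ea.
by subst o' a'; congr GroupoidFunctor; apply: Prop_irrelevance.
Qed.

Definition groupoid_functor_id (A : groupoid) : groupoid_functor A A.
Proof.
exists (fun x => x) (fun f => f) => // g f e e'.
by rewrite (Prop_irrelevance e e').
Defined.

Definition groupoid_functor_comp (A B C : groupoid)
    (G : groupoid_functor B C) (F : groupoid_functor A B) :
  groupoid_functor A C.
Proof.
exists (fun x => gf_obj G (gf_obj F x)) (fun f => gf_arr G (gf_arr F f)).
- by move=> f; rewrite !gf_src.
- by move=> f; rewrite !gf_tgt.
- by move=> x; rewrite !gf_id.
- move=> g f e e'.
  have e1 : gsrc (gf_arr F g) = gtgt (gf_arr F f).
    by rewrite gf_src gf_tgt e.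
  by rewrite (gf_comp e e1) (gf_comp e1 e').
Defined.

Definition Grpd : category.
Proof.
exists groupoid groupoid_functor groupoid_functor_id groupoid_functor_comp.
- by move=> *; apply: groupoid_functor_eq.
- by move=> *; apply: groupoid_functor_eq.
- by move=> *; apply: groupoid_functor_eq.
Defined.

(* In the codomain of [pact g], membership of [val (pact g u)] in [pdom g] is
   part of the typing.  In [pactM], the point x is [val u = val v], the type of
   [v] records x \in X_(h^-1 g^-1), and the hypothesis on [w] identifies it with
   \theta_h(x), which lies in X_(g^-1) by [pact_dom]. *)
Record partial_action := PartialAction {
  pgroup : groupType;
  pset : Type;
  pdom : pgroup -> set pset;
  pact : forall g, pdom g^-1 -> pdom g;
  pact_bij : forall g, bijective (@pact g);
  pdom1 : pdom 1 = setT;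
  pact1 : forall u : pdom 1^-1, val (pact u) = val u;
  pact_dom : forall g h (u : pdom g^-1), val u \in pdom (g^-1 * h) ->
    val (pact u) \in pdom g `&` pdom h;
  pactM : forall g h (u : pdom h^-1) (v : pdom (g * h)^-1) (w : pdom g^-1),
    val u = val v -> val w = val (pact u) -> val (pact w) = val (pact v) }.

Record pa_morphism (a b : partial_action) := PAMorphism {
  pam_set : pset a -> pset b;
  pam_group : pgroup a -> pgroup b;
  pam_groupM : {morph pam_group : g h / g * h};
  pam_dom : forall g, pam_set @` pdom g `<=` pdom (pam_group g);
  pam_act : forall g (u : pdom (p := a) g^-1)
      (v : pdom (p := b) (pam_group g)^-1),
    val v = pam_set (val u) -> pam_set (val (pact u)) = val (pact v) }.

Section PartialActionTheory.
Variable a : partial_action.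
Implicit Types (g h : pgroup a) (x y z : pset a).

(* [pact_rel g x y] : x \in X_(g^-1) and \theta_g(x) = y. *)
Definition pact_rel g x y : Prop :=
  exists u : pdom g^-1, val u = x /\ val (pact u) = y.

Lemma pact_rel_fun g x y z : pact_rel g x y -> pact_rel g x z -> y = z.
Proof. by move=> [u [<- <-]] [v [/val_inj -> <-]]. Qed.

Lemma pact_rel1 x : pact_rel 1 x x.
Proof.
have xP : x \in pdom (p := a) 1^-1 by rewrite invg1 pdom1 in_setT.
by exists (SigSub xP); rewrite pact1.
Qed.

Lemma pact_rel_dom g x : x \in pdom (p := a) g^-1 -> exists y, pact_rel g x y.
Proof. by move=> xP; exists (val (pact (SigSub xP))), (SigSub xP). Qed.

Lemma pact_rel_src g x y : pact_rel g x y -> x \in pdom g^-1.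
Proof. by move=> [u [<- _]]; exact: valP u. Qed.

Lemma pact_rel_tgt g x y : pact_rel g x y -> y \in pdom g.
Proof. by move=> [u [_ <-]]; exact: valP (pact u). Qed.

Lemma pact_rel_tgtI g h x y :
  pact_rel g x y -> x \in pdom (g^-1 * h) -> y \in pdom h.
Proof. by move=> [u [<- <-]] /pact_dom; rewrite in_setI => /andP[]. Qed.

Lemma pact_relM_in g h x y z : x \in pdom (g * h)^-1 ->
  pact_rel h x y -> pact_rel g y z -> pact_rel (g * h) x z.
Proof.
move=> xP [u [ux <-]] [w [wu <-]].
exists (SigSub xP); split => //.
by rewrite -(@pactM a g h u (SigSub xP) w).
Qed.

Lemma pact_relV g x y : pact_rel g x y -> pact_rel g^-1 y x.
Proof.
move=> gxy; have yP : y \in pdom (g^-1)^-1.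
  by rewrite invgK; apply: pact_rel_tgt gxy.
have [z gyz] := pact_rel_dom yP.
suff -> : x = z by [].
apply: (@pact_rel_fun 1 x); first exact: pact_rel1.
rewrite -(mulVg g); apply: (pact_relM_in _ gxy gyz).
by rewrite mulVg invg1 pdom1 in_setT.
Qed.

Lemma pact_relM g h x y z :
  pact_rel h x y -> pact_rel g y z -> pact_rel (g * h) x z.
Proof.
move=> hxy gyz; apply: (pact_relM_in _ hxy gyz).
apply: (pact_rel_tgtI (pact_relV hxy)).
by rewrite invgK invgM mulgA mulgV mul1g (pact_rel_src gyz).
Qed.

End PartialActionTheory.

Section PAMorphismTheory.
Variables (a b c : partial_action).

Lemma pam_group1 (f : pa_morphism a b) : pam_group f 1 = 1.
Proof.
by apply: (@mulgI _ (pam_group f 1)); rewrite -pam_groupM !mulg1.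
Qed.

Lemma pam_groupV (f : pa_morphism a b) g : pam_group f g^-1 = (pam_group f g)^-1.
Proof.
apply: (@mulgI _ (pam_group f g)).
by rewrite -pam_groupM !mulgV pam_group1.
Qed.

Lemma pam_domV (f : pa_morphism a b) g x : x \in pdom (p := a) g^-1 ->
  pam_set f x \in pdom (pam_group f g)^-1.
Proof. by rewrite -pam_groupV !inE => xP; apply: pam_dom; exists x. Qed.

Lemma pam_rel (f : pa_morphism a b) g x y :
  pact_rel g x y -> pact_rel (pam_group f g) (pam_set f x) (pam_set f y).
Proof.
move=> [u [<- <-]].
exists (SigSub (pam_domV f (valP u))); split => //.
by rewrite (pam_act (v := SigSub (pam_domV f (valP u)))).
Qed.

Lemma pa_morphism_eq (f g : pa_morphism a b) :
  pam_set f = pam_set g -> pam_group f = pam_group g -> f = g.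
Proof.
case: f => s h p1 p2 p3; case: g => s' h' q1 q2 q3 /= es eh.
by subst s' h'; congr PAMorphism; apply: Prop_irrelevance.
Qed.

Definition pa_morphism_comp (g : pa_morphism b c) (f : pa_morphism a b) :
  pa_morphism a c.
Proof.
exists (fun x => pam_set g (pam_set f x)) (fun k => pam_group g (pam_group f k)).
- by move=> k l; rewrite !pam_groupM.
- by move=> k _ [x xk <-]; apply: pam_dom; exists (pam_set f x) => //;
    apply: pam_dom; exists x.
- move=> k u v vu; pose w := SigSub (pam_domV f (valP u)).
  by rewrite (pam_act (v := w)) // (pam_act (v := v)).
Defined.

End PAMorphismTheory.

Definition pa_morphism_id (a : partial_action) : pa_morphism a a.
Proof.
exists (fun x => x) (fun k => k) => //.
- by move=> k _ [x xk <-].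
- by move=> k u v /val_inj ->.
Defined.

Definition PA : category.
Proof.
exists partial_action pa_morphism pa_morphism_id pa_morphism_comp.
- by move=> *; apply: pa_morphism_eq.
- by move=> *; apply: pa_morphism_eq.
- by move=> *; apply: pa_morphism_eq.
Defined.

Section PartialActionGroupoid.
Variable a : partial_action.

Definition pag_arrows : set (pset a * pgroup a * pset a) :=
  [set t | exists (g : pgroup a) (u : pdom g^-1),
    t = (val (pact u), g, val u)].

Lemma pag_arrowsE y g x : ((y, g, x) \in pag_arrows) <-> pact_rel g x y.
Proof.
rewrite inE; split=> [[h [u [-> eh ->]]]|[u [<- <-]]]; last by exists g, u.
by subst h; exists u.
Qed.

Lemma pag_arrowP (f : pag_arrows) :
  pact_rel (val f).1.2 (val f).2 (val f).1.1.
Proof. by case: f => [[[y g] x] fP] /=; apply/pag_arrowsE. Qed.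

Lemma pag_id_subproof x : (x, 1, x) \in pag_arrows.
Proof. by apply/pag_arrowsE/pact_rel1. Qed.

Lemma pag_inv_subproof (f : pag_arrows) :
  ((val f).2, (val f).1.2^-1, (val f).1.1) \in pag_arrows.
Proof. by apply/pag_arrowsE/pact_relV/pag_arrowP. Qed.

Lemma pag_comp_subproof (g f : pag_arrows) : (val g).2 = (val f).1.1 ->
  ((val g).1.1, (val g).1.2 * (val f).1.2, (val f).2) \in pag_arrows.
Proof.
move=> e; apply/pag_arrowsE; apply: pact_relM (pag_arrowP f) _.
by rewrite -e; apply: pag_arrowP.
Qed.

Definition partial_action_groupoid : groupoid.
Proof.
exists (pset a) pag_arrows
  (fun f => (val f).2)
  (fun f => (val f).1.1)
  (fun x => SigSub (pag_id_subproof x))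
  (fun f => SigSub (pag_inv_subproof f))
  (fun g f e => SigSub (@pag_comp_subproof g f e)) => //.
- by move=> h g f e1 e2 e3 e4; apply: val_inj; rewrite /= mulgA.
- by move=> [[[y g] x] fP] e; apply: val_inj; rewrite /= mul1g.
- by move=> [[[y g] x] fP] e; apply: val_inj; rewrite /= mulg1.
- by move=> [[[y g] x] fP] e; apply: val_inj; rewrite /= mulVg.
- by move=> [[[y g] x] fP] e; apply: val_inj; rewrite /= mulgV.
Defined.

End PartialActionGroupoid.

Arguments pag_arrows a _ : clear implicits.

Section PsiMap.
Variables (a b : partial_action) (f : pa_morphism a b).

Lemma psi_map_subproof (t : pag_arrows a) :
  (pam_set f (val t).1.1, pam_group f (val t).1.2, pam_set f (val t).2)
    \in pag_arrows b.
Proof. by apply/pag_arrowsE/pam_rel/pag_arrowP. Qed.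

Definition psi_map :
  groupoid_functor (partial_action_groupoid a) (partial_action_groupoid b).
Proof.
exists (pam_set f) (fun t => SigSub (psi_map_subproof t)) => //.
- by move=> x; apply: val_inj; rewrite /= pam_group1.
- by move=> t s e e'; apply: val_inj; rewrite /= pam_groupM.
Defined.

End PsiMap.

Definition Psi : functor PA Grpd.
Proof.
exists (partial_action_groupoid : PA -> Grpd) psi_map.
- move=> a; apply: groupoid_functor_eq => //.
  by apply: funext => -[[[y g] x] tP]; apply: val_inj.
- move=> a b c g f; apply: groupoid_functor_eq => //.
  by apply: funext => t; apply: val_inj.
Defined.

Definition lifts_isomorphisms (A : Grpd) (a : PA) (eta : hom (Psi a) A)
    : Prop :=
  forall (b : PA) (f : hom A (Psi b)), is_iso f ->
    exists! phi : hom a b, fmap Psi phi = f \oc eta.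

(* Main.v *)
Require Import Defs.
From HB Require Import structures.
From mathcomp Require Import all_boot.
From mathcomp Require Import generic_quotient.
From mathcomp Require Import boolp classical_sets.

(* [Phi A] is the partial action of the universal group U of A (words in the
   arrows, modulo the relations that hold under every functor from A to a group)
   on the objects of A, where [u] sends [x] to [y] when [u] is the class of an
   arrow from x to y.  This is well defined, and A is recovered as its groupoid,
   because an arrow is determined by its source and its class in U.  To see the
   latter, let A act on sets, every action factoring through U: on functions from
   objects to bool, an arrow flipping the values at its source and its target,
   which detects the target; and on arrows, by the loops at the common source x0
   obtained by choosing an arrow from x0 to every object of its component, which
   detects the arrow once its endpoints are known.  The universal property of U
   makes A -> Psi (Phi A) a universal arrow, and the rest is formal. *)

Set Implicit Arguments.
Unset Strict Implicit.
Unset Printing Implicit Defensive.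

Local Open Scope quotient_scope.
Local Open Scope cat_scope.

(** * Permutations of an arbitrary type as a group *)

Section SymmetricGroup.
Variable T : Type.

(** The inverse is kept as data, so that inversion swaps the fields; it is determined by the map. *)
Record symmetry := Symmetry {
  sym_fun :> T -> T;
  sym_inv : T -> T;
  sym_funK : cancel sym_fun sym_inv;
  sym_invK : cancel sym_inv sym_fun }.

HB.instance Definition _ := gen_eqMixin symmetry.
HB.instance Definition _ := gen_choiceMixin symmetry.

Lemma symmetry_eq (p q : symmetry) : p =1 q -> p = q.
Proof.
case: p => f f' fK f'K; case: q => g g' gK g'K /= /funext fg; subst g.
have fg' : f' = g' by apply: funext => x; rewrite -{1}[x]g'K fK.
by subst g'; congr Symmetry; apply: Prop_irrelevance.
Qed.

Definition symmetry_one : symmetry := @Symmetry id id (fun=> erefl) (fun=> erefl).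

Definition symmetry_mul (p q : symmetry) : symmetry :=
  Symmetry (can_comp (sym_funK p) (sym_funK q))
    (can_comp (sym_invK q) (sym_invK p)).

Definition symmetry_inv (p : symmetry) : symmetry :=
  Symmetry (sym_invK p) (sym_funK p).

Lemma symmetry_mulA : associative symmetry_mul.
Proof. by move=> p q r; apply: symmetry_eq. Qed.

Lemma symmetry_mul1 : left_id symmetry_one symmetry_mul.
Proof. by move=> p; apply: symmetry_eq. Qed.

Lemma symmetry_mulr1 : right_id symmetry_one symmetry_mul.
Proof. by move=> p; apply: symmetry_eq. Qed.

Lemma symmetry_mulV : left_inverse symmetry_one symmetry_inv symmetry_mul.
Proof. by move=> p; apply: symmetry_eq => x; apply: sym_funK. Qed.

Lemma symmetry_mulrV : right_inverse symmetry_one symmetry_inv symmetry_mul.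
Proof. by move=> p; apply: symmetry_eq => x; apply: sym_invK. Qed.

HB.instance Definition _ := isGroup.Build symmetry
  symmetry_mulA symmetry_mul1 symmetry_mulr1 symmetry_mulV symmetry_mulrV.

End SymmetricGroup.

(** * Cancellation laws for a total composition of arrows *)

Section GroupoidMul.
Variable A : groupoid.
Implicit Types f g h : garr A.

(* Total composition; the junk value [f] makes [gmul g] act on all arrows. *)
Definition gmul g f : garr A :=
  if pselect (gsrc g = gtgt f) is left e then gcomp e else f.

Lemma gmulE g f (e : gsrc g = gtgt f) : gmul g f = gcomp e.
Proof.
by rewrite /gmul; case: pselect => // e'; rewrite (Prop_irrelevance e' e).
Qed.

Lemma gmul_junk g f : gsrc g <> gtgt f -> gmul g f = f.
Proof. by rewrite /gmul; case: pselect. Qed.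

Lemma gsrc_mul g f : gsrc (gmul g f) = gsrc f.
Proof. by rewrite /gmul; case: pselect => // e; rewrite gsrc_comp. Qed.

Lemma gtgt_mul g f : gsrc g = gtgt f -> gtgt (gmul g f) = gtgt g.
Proof. by move=> e; rewrite (gmulE e) gtgt_comp. Qed.

Lemma gmulA h g f : gsrc h = gtgt g -> gsrc g = gtgt f ->
  gmul h (gmul g f) = gmul (gmul h g) f.
Proof.
move=> e1 e2; have e3 : gsrc h = gtgt (gcomp e2) by rewrite gtgt_comp.
have e4 : gsrc (gcomp e1) = gtgt f by rewrite gsrc_comp.
by rewrite (gmulE e1) (gmulE e2) (gmulE e3) (gmulE e4) (gcompA e3 e4).
Qed.

Lemma gmul1 x f : gmul (gid x) f = f.
Proof.
have [e|] := pselect (x = gtgt f); last first.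
  by move=> ne; apply: gmul_junk; rewrite gsrc_id.
have e1 : gsrc (gid (gtgt f)) = gtgt f by rewrite gsrc_id.
by rewrite e (gmulE e1) gcomp1f.
Qed.

Lemma gmulr1 f : gmul f (gid (gsrc f)) = f.
Proof.
have e : gsrc f = gtgt (gid (gsrc f)) by rewrite gtgt_id.
by rewrite (gmulE e) gcompf1.
Qed.

Lemma gmulVf f : gmul (ginv f) f = gid (gsrc f).
Proof. by rewrite (gmulE (gsrc_inv f)) gcompVf. Qed.

Lemma gmulfV f : gmul f (ginv f) = gid (gtgt f).
Proof. by rewrite (gmulE (esym (gtgt_inv f))) gcompfV. Qed.

Lemma gmulKV f g : gtgt f = gtgt g -> gmul f (gmul (ginv f) g) = g.
Proof. by move=> e; rewrite gmulA ?gtgt_inv ?gsrc_inv// gmulfV gmul1. Qed.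

Lemma gmulK f g : gsrc f = gtgt g -> gmul (ginv f) (gmul f g) = g.
Proof. by move=> e; rewrite gmulA ?gtgt_inv ?gsrc_inv// gmulVf gmul1. Qed.

Lemma gmulI h f g : gsrc h = gtgt f -> gsrc h = gtgt g ->
  gmul h f = gmul h g -> f = g.
Proof. by move=> ef eg E; rewrite -(gmulK ef) E gmulK. Qed.

Lemma gmulIr h f g : gsrc f = gtgt h -> gsrc g = gtgt h ->
  gmul f h = gmul g h -> f = g.
Proof.
move=> ef eg E.
have K k : gsrc k = gtgt h -> gmul (gmul k h) (ginv h) = k.
  by move=> ek; rewrite -gmulA ?gtgt_inv// gmulfV -ek gmulr1.
by rewrite -(K f ef) E K.
Qed.

End GroupoidMul.

(** * The universal group of a groupoid *)

Section UniversalGroup.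
Local Open Scope group_scope.
Variable A : groupoid.

(** A functor from [A] to the one-object groupoid [H]; cancellation in [H] makes it preserve units
    and inverses. *)
Definition groupoid_rep (H : groupType) (F : garr A -> H) : Prop :=
  forall g f, gsrc g = gtgt f -> F (gmul g f) = F g * F f.

Section Rep.
Variables (H : groupType) (F : garr A -> H).
Hypothesis repF : groupoid_rep F.

Lemma groupoid_rep1 x : F (gid x) = 1.
Proof.
apply: (@mulgI _ (F (gid x))).
by rewrite -repF ?gsrc_id ?gtgt_id// gmul1 mulg1.
Qed.

Lemma groupoid_repV f : F (ginv f) = (F f)^-1.
Proof.
apply: (@mulIg _ (F f)); rewrite -repF ?gsrc_inv//.
by rewrite gmulVf groupoid_rep1 mulVg.
Qed.

End Rep.

(* The quantification over all groups is impredicative, so that the quotient of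
   words stays in the universe of the arrows. *)
Definition word_equiv (v w : seq {classic garr A}) : bool :=
  `[< forall (H : groupType) (F : garr A -> H), groupoid_rep F ->
      \prod_(f <- v) F f = \prod_(f <- w) F f >].

Lemma word_equiv_refl : reflexive word_equiv.
Proof. by move=> w; apply/asboolP. Qed.

Lemma word_equiv_sym : symmetric word_equiv.
Proof.
by move=> v w; apply/idP/idP => /asboolP E; apply/asboolP => H F /E.
Qed.

Lemma word_equiv_trans : transitive word_equiv.
Proof.
move=> v u w /asboolP E /asboolP E'; apply/asboolP => H F repF.
by rewrite E // E'.
Qed.

Definition word_equiv_rel :=
  EquivRel word_equiv word_equiv_refl word_equiv_sym word_equiv_trans.

Definition ugroup : Type := {eq_quot word_equiv_rel}.
HB.instance Definition _ := Choice.on ugroup.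

Definition ugroup_of_word (w : seq (garr A)) : ugroup :=
  \pi_({eq_quot word_equiv_rel}) w.

Definition ugen (f : garr A) : ugroup := ugroup_of_word [:: f].

Definition uword (u : ugroup) : seq (garr A) :=
  repr (u : {eq_quot word_equiv_rel}).

Lemma uwordK : cancel uword ugroup_of_word.
Proof. exact: reprK. Qed.

Lemma ugroup_of_wordP v w :
  reflect (ugroup_of_word v = ugroup_of_word w) (word_equiv v w).
Proof. exact: (@eqquotP _ _ {eq_quot word_equiv_rel}). Qed.

(** Evaluates a chosen representative word; by [ulift_word] the choice is immaterial once [F] is a
    representation. *)
Definition ulift (H : groupType) (F : garr A -> H) (u : ugroup) : H :=
  \prod_(f <- uword u) F f.

Lemma ulift_word (H : groupType) (F : garr A -> H) w : groupoid_rep F ->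
  ulift F (ugroup_of_word w) = \prod_(f <- w) F f.
Proof.
move=> repF; have /ugroup_of_wordP/asboolP := uwordK (ugroup_of_word w).
exact.
Qed.

Lemma ulift_gen (H : groupType) (F : garr A -> H) f : groupoid_rep F ->
  ulift F (ugen f) = F f.
Proof. by move=> repF; rewrite ulift_word // big_seq1. Qed.

(** Words are identified exactly when all representations agree on them, so the group laws can be
    checked in each [H]. *)
Lemma ugroup_ext (u v : ugroup) :
  (forall (H : groupType) (F : garr A -> H), groupoid_rep F ->
     ulift F u = ulift F v) -> u = v.
Proof.
move=> E; rewrite -[u]uwordK -[v]uwordK.
by apply/ugroup_of_wordP/asboolP => H F /E.
Qed.

Definition ugroup_mul (u v : ugroup) := ugroup_of_word (uword u ++ uword v).
Definition ugroup_one := ugroup_of_word [::].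
Definition ugroup_inv (u : ugroup) :=
  ugroup_of_word (rev (map (@ginv A) (uword u))).

Section Lift.
Variables (H : groupType) (F : garr A -> H).
Hypothesis repF : groupoid_rep F.

Lemma uliftM u v : ulift F (ugroup_mul u v) = ulift F u * ulift F v.
Proof. by rewrite ulift_word // big_cat. Qed.

Lemma ulift1 : ulift F ugroup_one = 1.
Proof. by rewrite ulift_word // big_nil. Qed.

Lemma uliftV u : ulift F (ugroup_inv u) = (ulift F u)^-1.
Proof.
rewrite ulift_word // -map_rev big_map.
under eq_bigr do rewrite groupoid_repV //.
by rewrite prodgV revK.
Qed.

End Lift.

Lemma ugroup_mulA : associative ugroup_mul.
Proof. by move=> u v w; apply: ugroup_ext => H F ?; rewrite !uliftM // mulgA. Qed.

Lemma ugroup_mul1 : left_id ugroup_one ugroup_mul.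
Proof. by move=> u; apply: ugroup_ext => H F ?; rewrite uliftM // ulift1 // mul1g. Qed.

Lemma ugroup_mulr1 : right_id ugroup_one ugroup_mul.
Proof. by move=> u; apply: ugroup_ext => H F ?; rewrite uliftM // ulift1 // mulg1. Qed.

Lemma ugroup_mulV : left_inverse ugroup_one ugroup_inv ugroup_mul.
Proof.
by move=> u; apply: ugroup_ext => H F ?; rewrite uliftM // uliftV // ulift1 // mulVg.
Qed.

Lemma ugroup_mulrV : right_inverse ugroup_one ugroup_inv ugroup_mul.
Proof.
by move=> u; apply: ugroup_ext => H F ?; rewrite uliftM // uliftV // ulift1 // mulgV.
Qed.

HB.instance Definition _ := isGroup.Build ugroup
  ugroup_mulA ugroup_mul1 ugroup_mulr1 ugroup_mulV ugroup_mulrV.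

Lemma ugen_rep : groupoid_rep ugen.
Proof.
move=> g f e; apply: ugroup_ext => H F repF.
by rewrite [ugen g * ugen f]/(ugroup_mul _ _) uliftM // !ulift_gen // repF.
Qed.

Lemma ugroup_of_wordE w : ugroup_of_word w = \prod_(f <- w) ugen f.
Proof.
elim: w => [|f w IHw]; first by rewrite big_nil.
rewrite big_cons -IHw; apply: ugroup_ext => H F repF.
by rewrite [_ * _]/(ugroup_mul _ _) uliftM // !ulift_word // big_seq1 big_cons.
Qed.

(** The classes of arrows generate: each element is the product of the classes of the letters of a
    representative word. *)
Lemma ugroup_morph_eq (H : groupType) (p q : ugroup -> H) :
  {morph p : u v / u * v} -> {morph q : u v / u * v} ->
  (forall f, p (ugen f) = q (ugen f)) -> p =1 q.
Proof.
move=> pM qM pq u.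
have morph1 (r : ugroup -> H) : {morph r : u v / u * v} -> r 1 = 1.
  by move=> rM; apply: (@mulgI _ (r 1)); rewrite -rM !mulg1.
rewrite -[u]uwordK ugroup_of_wordE; elim: (uword u) => [|f w IHw].
  by rewrite big_nil !morph1.
by rewrite big_cons pM qM pq IHw.
Qed.

(** * Separating arrows with a common source by their classes *)

Lemma ugen_act (T : Type) (act : garr A -> T -> T) :
  (forall x, act (gid x) =1 id) ->
  (forall g f, gsrc g = gtgt f -> act (gmul g f) =1 act g \o act f) ->
  forall f g, ugen f = ugen g -> act f =1 act g.
Proof.
move=> act1 actM f g.
have actK h : cancel (act h) (act (ginv h)).
  move=> t; rewrite -[LHS]/((act (ginv h) \o act h) t) -actM ?gsrc_inv//.
  by rewrite gmulVf act1.
have actVK h : cancel (act (ginv h)) (act h).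
  move=> t; rewrite -[LHS]/((act h \o act (ginv h)) t) -actM ?gtgt_inv//.
  by rewrite gmulfV act1.
(* An action is a representation by permutations of [T], so it factors through the universal
   group. *)
pose rho h : symmetry T := Symmetry (actK h) (actVK h).
have repF : groupoid_rep rho by move=> h k e; apply: symmetry_eq; apply: actM.
move=> E t; have : ulift rho (ugen f) = ulift rho (ugen g) by rewrite E.
by rewrite !ulift_gen // => /(congr1 (fun p : symmetry T => p t)).
Qed.

Lemma ugen_tgt f g : gsrc f = gsrc g -> ugen f = ugen g -> gtgt f = gtgt g.
Proof.
move=> efg ufg.
(* The two flips of an identity cancel, as do the flips at the middle object of a composite, so this
   is an action. *)
pose act h (s : gobj A -> bool) z :=
  s z (+) `[< z = gsrc h >] (+) `[< z = gtgt h >].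
have : act f =1 act g.
  apply: (ugen_act _ _ ufg) => [x s|h k e s]; apply: funext => z.
    by rewrite /act gsrc_id gtgt_id addbK.
  by rewrite /act /= gsrc_mul gtgt_mul // e addbK.
move=> /(_ (fun=> false))/(congr1 (fun s : gobj A -> bool => s (gtgt f))).
(* The flips at the common source cancel; what remains compares [gtgt f] with [gtgt g]. *)
rewrite /act efg => /addbI; rewrite asboolT // => /esym.
by move=> /asboolP.
Qed.

Section Loops.
Variable x0 : gobj A.

Definition to_obj z h := gsrc h = x0 /\ gtgt h = z.

Definition transport z : garr A :=
  if pselect (exists h, to_obj z h) is left e then projT1 (cid e) else gid x0.

Lemma transportP z h : to_obj z h -> to_obj z (transport z).
Proof.
rewrite /transport => zh; case: pselect => [e|[]]; last by exists h.
by case: (cid e).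
Qed.

(** Conjugates [h] to a loop at [x0] along the chosen arrows; the value [gid x0] outside the
    component of [x0] keeps [loop] multiplicative on all arrows. *)
Definition loop h : garr A :=
  if `[< exists k, to_obj (gsrc h) k >]
  then gmul (ginv (transport (gtgt h))) (gmul h (transport (gsrc h)))
  else gid x0.

Lemma loopP h : gsrc (loop h) = x0 /\ gtgt (loop h) = x0.
Proof.
rewrite /loop; case: asboolP => [[k zk]|_]; last by rewrite gsrc_id gtgt_id.
have [s t] := transportP zk.
have [s' t'] : to_obj (gtgt h) (transport (gtgt h)).
  by apply: (@transportP _ (gmul h k)); case: zk => ? ?;
    split; rewrite ?gsrc_mul ?gtgt_mul.
split; first by rewrite !gsrc_mul s.
by rewrite gtgt_mul ?gtgt_inv // gsrc_inv t' gtgt_mul.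
Qed.

(** The chosen arrow at the middle object cancels against its inverse. *)
Lemma loopM g f : gsrc g = gtgt f -> loop (gmul g f) = gmul (loop g) (loop f).
Proof.
move=> e; rewrite /loop gsrc_mul gtgt_mul //.
(* Composable arrows lie in one component, so all three loops fall in the same case. *)
have -> : (exists k, to_obj (gsrc g) k) = (exists k, to_obj (gsrc f) k).
  apply: propext; split=> -[k [ks kt]].
    by exists (gmul (ginv f) k); split; rewrite ?gsrc_mul // gtgt_mul
      ?gtgt_inv // gsrc_inv kt e.
  by exists (gmul f k); split; rewrite ?gsrc_mul // gtgt_mul.
case: asboolP => [[k [ks kt]]|_]; last by rewrite gmul1.
have [s t] := transportP (conj ks kt).
have [s' t'] : to_obj (gsrc g) (transport (gsrc g)).
  by apply: (@transportP _ (gmul f k)); split; rewrite ?gsrc_mul ?gtgt_mul.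
have [s'' t''] : to_obj (gtgt g) (transport (gtgt g)).
  apply: (@transportP _ (gmul g (transport (gsrc g)))).
  by split; rewrite ?gsrc_mul ?gtgt_mul.
have tf : gtgt (gmul f (transport (gsrc f))) = gsrc g by rewrite gtgt_mul.
have tV : gtgt (gmul (ginv (transport (gsrc g))) (gmul f (transport (gsrc f))))
    = x0 by rewrite gtgt_mul ?gtgt_inv // gsrc_inv t' tf.
have gt : gtgt (gmul g (transport (gsrc g))) = gtgt g by rewrite gtgt_mul ?t'.
rewrite -e; rewrite -[RHS]gmulA; first last.
- by rewrite gsrc_mul s' tV.
- by rewrite gsrc_inv t'' gt.
by rewrite -(gmulA (esym t')) ?s' ?tV // gmulKV ?t' ?tf // -(gmulA e) ?t.
Qed.

End Loops.

(** Equal classes make the loops of [f] and [g] at their common source act alike; acting on [gid x0]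
    they are equal. The endpoints agree by [ugen_tgt], so the same chosen arrows are cancelled on
    both sides. *)
Lemma ugen_star_inj f g : gsrc f = gsrc g -> ugen f = ugen g -> f = g.
Proof.
move=> efg E; have tfg := ugen_tgt efg E.
pose x0 := gsrc f.
have : gmul (loop x0 f) =1 gmul (loop x0 g).
  apply: (ugen_act (act := fun h => gmul (loop x0 h))) E => [x k|h k e a].
    rewrite /loop gsrc_id gtgt_id gmul1; case: asboolP => [[h xh]|_].
      by rewrite gmulVf gmul1.
    by rewrite gmul1.
  have [hs ht] := loopP x0 h; have [ks kt] := loopP x0 k.
  rewrite /= loopM //; have [ea|nea] := pselect (x0 = gtgt a).
    by rewrite gmulA // ?ks ?hs.
  (* An arrow that does not end at [x0] is fixed by every loop, through the default value of
     [gmul]. *)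
  rewrite (@gmul_junk _ (loop x0 k)) ?ks // gmul_junk ?gsrc_mul ?ks //.
  by rewrite gmul_junk ?hs.
move/(_ (gid x0)).
have rid h : gmul (loop x0 h) (gid x0) = loop x0 h.
  by rewrite -{2}(loopP x0 h).1 gmulr1.
rewrite !rid /loop -efg -tfg; case: asboolP => [[k xk]|[]]; last first.
  by exists (gid x0); split; rewrite ?gsrc_id ?gtgt_id.
have [s t] := transportP xk.
have [s' t'] : to_obj x0 (gtgt f) (transport x0 (gtgt f)).
  by apply: (@transportP _ _ f).
(* The chosen arrow from [x0] to itself need not be an identity, so it too is cancelled. *)
move=> /gmulI E'; apply: (@gmulIr _ (transport x0 x0)); rewrite ?t -?efg //.
by apply: E'; rewrite gsrc_inv t' gtgt_mul ?t -?efg.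
Qed.

End UniversalGroup.

(** * The partial action of the universal group on objects *)

Section UniversalPartialAction.
Local Open Scope group_scope.
Local Open Scope classical_set_scope.
Variable A : groupoid.
Local Notation U := (ugroup A).

Definition upa_dom (g : U) : set (gobj A) :=
  [set y | exists f : garr A, gtgt f = y /\ ugen f = g].

Lemma upa_domV g x : x \in upa_dom g^-1 ->
  exists f : garr A, gsrc f = x /\ ugen f = g.
Proof.
rewrite inE => -[f [fx fg]]; exists (ginv f).
by rewrite gsrc_inv (groupoid_repV (@ugen_rep A)) fg invgK.
Qed.

Lemma upa_domP g y : y \in upa_dom g ->
  exists f : garr A, gtgt f = y /\ ugen f = g.
Proof. by rewrite inE. Qed.

Lemma gtgt_upa_dom f : gtgt f \in upa_dom (ugen f).
Proof. by rewrite inE; exists f. Qed.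

Lemma gsrc_upa_dom f : gsrc f \in upa_dom (ugen f)^-1.
Proof.
rewrite inE; exists (ginv f).
by rewrite gtgt_inv (groupoid_repV (@ugen_rep A)).
Qed.

Definition upa_arr g (u : upa_dom g^-1) : garr A :=
  projT1 (cid (upa_domV (valP u))).

Lemma upa_arrP g (u : upa_dom g^-1) :
  gsrc (upa_arr u) = val u /\ ugen (upa_arr u) = g.
Proof. by rewrite /upa_arr; case: cid. Qed.

Lemma upa_act_subproof g (u : upa_dom g^-1) : gtgt (upa_arr u) \in upa_dom g.
Proof. by rewrite -{2}(upa_arrP u).2 gtgt_upa_dom. Qed.

Definition upa_act g (u : upa_dom g^-1) : upa_dom g :=
  SigSub (upa_act_subproof u).

(** By [ugen_star_inj] the arrow chosen in [upa_arr] is the only candidate. *)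
Lemma upa_actE g (u : upa_dom g^-1) f : gsrc f = val u -> ugen f = g ->
  val (upa_act u) = gtgt f.
Proof.
move=> fu fg; have [au ag] := upa_arrP u; congr gtgt.
by apply: ugen_star_inj; rewrite ?au ?ag.
Qed.

(** Star injectivity applied to inverse arrows; it makes the action maps injective. *)
Lemma ugen_costar_inj f g : gtgt f = gtgt g -> ugen f = ugen g -> f = g :> garr A.
Proof.
move=> t ufg; have : ginv f = ginv g.
  by apply: ugen_star_inj; rewrite ?gsrc_inv // !(groupoid_repV (@ugen_rep A)) ufg.
move=> E; have s : gsrc f = gsrc g by rewrite -!gtgt_inv E.
exact: ugen_star_inj.
Qed.

Lemma upa_act_bij g : bijective (@upa_act g).
Proof.
have inv_dom (v : upa_dom g) : {u : upa_dom g^-1 | upa_act u = v}.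
  apply: cid; have [f [fv fg]] := upa_domP (valP v).
  have fs : gsrc f \in upa_dom g^-1 by rewrite -fg gsrc_upa_dom.
  exists (SigSub fs); apply: val_inj.
  by rewrite (@upa_actE _ (SigSub fs) f).
exists (fun v => projT1 (inv_dom v)) => [u|v]; last by case: (inv_dom v).
case: (inv_dom _) => u' /= /(congr1 val)/= E; apply: val_inj.
have [us ug] := upa_arrP u; have [us' ug'] := upa_arrP u'.
by rewrite -us -us'; congr gsrc; apply: ugen_costar_inj; rewrite ?ug ?ug'.
Qed.

Lemma upa_dom1 : upa_dom 1 = setT.
Proof.
apply/seteqP; split=> // x _; exists (gid x).
by rewrite gtgt_id (groupoid_rep1 (@ugen_rep A)).
Qed.

Lemma upa_act1 (u : upa_dom 1^-1) : val (upa_act u) = val u.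
Proof.
rewrite (@upa_actE _ _ (gid (val u))) ?gtgt_id ?gsrc_id //.
exact: (groupoid_rep1 (@ugen_rep A)).
Qed.

Lemma upa_act_dom g h (u : upa_dom g^-1) : val u \in upa_dom (g^-1 * h) ->
  val (upa_act u) \in upa_dom g `&` upa_dom h.
Proof.
rewrite in_setI (valP (upa_act u)) /= => /upa_domP[f [fu fh]].
(* Here [f] has class [g^-1 * h] and ends at [val u]; following it by the arrow of class [g] gives
   class [h]. *)
have [us ug] := upa_arrP u; rewrite inE; exists (gmul (upa_arr u) f).
have e : gsrc (upa_arr u) = gtgt f by rewrite us fu.
by rewrite gtgt_mul // (ugen_rep e) ug fh mulgA mulgV mul1g.
Qed.

Lemma upa_actM g h (u : upa_dom h^-1) (v : upa_dom (g * h)^-1)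
    (w : upa_dom g^-1) :
  val u = val v -> val w = val (upa_act u) -> val (upa_act w) = val (upa_act v).
Proof.
move=> uv wu; have [us ug] := upa_arrP u; have [ws wg] := upa_arrP w.
have e : gsrc (upa_arr w) = gtgt (upa_arr u) by rewrite ws wu.
rewrite (@upa_actE _ v (gmul (upa_arr w) (upa_arr u))) ?gtgt_mul //.
  by rewrite gsrc_mul us.
by rewrite (ugen_rep e) wg ug.
Qed.

Definition upa : partial_action :=
  PartialAction upa_act_bij upa_dom1 upa_act1 upa_act_dom upa_actM.

Lemma upa_rel f : pact_rel (a := upa) (ugen f) (gsrc f) (gtgt f).
Proof. by exists (SigSub (gsrc_upa_dom f)); rewrite (@upa_actE _ _ f). Qed.

Lemma upa_relP g x y : pact_rel (a := upa) g x y ->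
  exists f, [/\ gsrc f = x, gtgt f = y & ugen f = g].
Proof.
move=> [u [<- <-]]; exists (upa_arr u).
by have [-> ->] := upa_arrP u.
Qed.

(** * The unit isomorphism from a groupoid to its partial action groupoid *)

Lemma unit_arr_subproof f : (gtgt f, ugen f, gsrc f) \in @pag_arrows upa.
Proof. by apply/pag_arrowsE/upa_rel. Qed.

(** The universal arrow points out of [A]; the [eta] of the theorem is its inverse. *)
Definition upa_unit : hom (A : Grpd) (Psi upa).
Proof.
exists (id : gobj A -> gobj (partial_action_groupoid upa))
  (fun f => SigSub (unit_arr_subproof f)) => //.
- move=> x; apply: val_inj => /=.
  by rewrite gtgt_id gsrc_id (groupoid_rep1 (@ugen_rep A)).
- move=> g f e e'; apply: val_inj => /=.
  by rewrite gtgt_comp gsrc_comp -(gmulE e) (ugen_rep e).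
Defined.

Definition unit_inv_arr (t : pag_arrows upa) : garr A :=
  projT1 (cid (upa_relP (pag_arrowP t))).

Lemma unit_inv_arrP (t : pag_arrows upa) (f := unit_inv_arr t) :
  [/\ gsrc f = (val t).2, gtgt f = (val t).1.1 & ugen f = (val t).1.2].
Proof. by rewrite /f /unit_inv_arr; case: cid. Qed.

Lemma unit_arrK f : unit_inv_arr (gf_arr upa_unit f) = f.
Proof.
by have [s _ g] := unit_inv_arrP (gf_arr upa_unit f); apply: ugen_star_inj.
Qed.

Lemma unit_inv_arrK t : gf_arr upa_unit (unit_inv_arr t) = t.
Proof.
have [s t' g] := unit_inv_arrP t; apply: val_inj => /=.
by rewrite s t' g; case: t {s t' g} => [[[y g] x] tP].
Qed.

Lemma upa_unit_iso : is_iso upa_unit.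
Proof.
unshelve eexists.
- exists (id : gobj (partial_action_groupoid upa) -> gobj A) unit_inv_arr.
  + by move=> t; have [] := unit_inv_arrP t.
  + by move=> t; have [] := unit_inv_arrP t.
  (* Writing the right side as [unit_inv_arr] of its image turns the functor laws into equations
     between triples. *)
  + move=> x; rewrite -[RHS]unit_arrK; congr unit_inv_arr; apply: val_inj => /=.
    by rewrite gtgt_id gsrc_id (groupoid_rep1 (@ugen_rep A)).
  + move=> g f e e'; rewrite -[RHS]unit_arrK; congr unit_inv_arr.
    have [sg tg ug] := unit_inv_arrP g; have [sf tf uf] := unit_inv_arrP f.
    apply: val_inj => /=.
    by rewrite gtgt_comp gsrc_comp -(gmulE e') (ugen_rep e') ug uf tg sf.
- split; apply: groupoid_functor_eq => //=; apply: funext => f.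
    exact: unit_arrK.
  exact: unit_inv_arrK.
Qed.

(** * The unit as a universal arrow *)

Section UniversalProperty.
Variables (b : partial_action) (F : hom (A : Grpd) (Psi b)).

Definition functor_label (f : garr A) : pgroup b := (val (gf_arr F f)).1.2.

Lemma functor_label_rel f :
  pact_rel (functor_label f) (gf_obj F (gsrc f)) (gf_obj F (gtgt f)).
Proof. by rewrite -gf_src -gf_tgt; apply: pag_arrowP. Qed.

Lemma functor_label_rep : groupoid_rep functor_label.
Proof.
move=> g f e.
have e' : gsrc (gf_arr F g) = gtgt (gf_arr F f) by rewrite gf_src gf_tgt e.
by rewrite /functor_label (gmulE e) (gf_comp e e').
Qed.

Definition upa_lift : hom (upa : PA) b.
Proof.
exists (gf_obj F : pset upa -> pset b) (ulift functor_label).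
- by move=> g h; apply: uliftM functor_label_rep _ _.
- move=> _ _ [_ [f [<- <-]] <-].
  rewrite ulift_gen; last exact: functor_label_rep.
  by have /pact_rel_tgt := functor_label_rel f; rewrite inE.
- move=> g u v vu; have [us ug] := upa_arrP u.
  (* [pact_rel] is single-valued, so it suffices that both points are images of [val v] under the
     same group element. *)
  apply: (@pact_rel_fun b (ulift functor_label g) (val v)); last by exists v.
  rewrite vu -us -{1}ug ulift_gen; last exact: functor_label_rep.
  exact: functor_label_rel.
Defined.

Lemma upa_liftP : fmap Psi upa_lift \oc upa_unit = F.
Proof.
apply: groupoid_functor_eq => //; apply: funext => f; apply: val_inj => /=.
rewrite ulift_gen; last exact: functor_label_rep.
by rewrite -gf_src -gf_tgt /functor_label /=; case: (gf_arr F f) => [[[y g] x] ?].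
Qed.

(** The unit is the identity on objects and labels [f] by [ugen f], so the equation fixes [phi] on
    points and on generators. *)
Lemma upa_lift_unique (phi : hom (upa : PA) b) :
  fmap Psi phi \oc upa_unit = F -> phi = upa_lift.
Proof.
move=> phiF; apply: pa_morphism_eq; first by rewrite -[RHS]/(gf_obj F) -phiF.
apply: funext; apply: (@ugroup_morph_eq A (pgroup b)).
- exact: (pam_groupM phi).
- exact: (pam_groupM upa_lift).
- move=> f; rewrite /= ulift_gen; last exact: functor_label_rep.
  by rewrite /functor_label -phiF.
Qed.

End UniversalProperty.

End UniversalPartialAction.

(** * Left adjoints from universal arrows *)

Section UniversalArrows.
Variables (C D : category) (R : functor D C) (L : C -> D).
Variables (unit : forall a, hom a (R (L a)))
  (lift : forall a b, hom a (R b) -> hom (L a) b).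
Hypothesis liftP : forall a b (f : hom a (R b)),
  fmap R (lift f) \oc unit a = f.
Hypothesis lift_unique : forall a b (f : hom a (R b)) (m : hom (L a) b),
  fmap R m \oc unit a = f -> m = lift f.

(** Both are the lift of the common composite; the functor laws of [left_adjoint] are checked this
    way. *)
Lemma unit_monic a b (m n : hom (L a) b) :
  fmap R m \oc unit a = fmap R n \oc unit a -> m = n.
Proof. by move=> /lift_unique ->; apply/esym/lift_unique. Qed.

Definition left_adjoint : functor C D.
Proof.
exists L (fun a b f => lift (unit b \oc f)) => [a|a b c g f]; apply: unit_monic.
  by rewrite liftP fmap_id ccomp1f ccompf1.
by rewrite fmap_comp -[RHS]ccompA !liftP !ccompA liftP.
Defined.

Lemma left_adjoint_unit a a' (f : hom a a') :
  fmap R (fmap left_adjoint f) \oc unit a = unit a' \oc f.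
Proof. exact: liftP. Qed.

(** Transposition along the unit has inverse [lift]; naturality in the two variables is that of the
    unit and functoriality of [R]. *)
Lemma left_adjointP : adjoint left_adjoint R.
Proof.
exists (fun a b m => fmap R m \oc unit a); split=> [a b|a a' b k m|a b b' k m].
- by exists (@lift a b) => [m|f]; [apply/esym/lift_unique | apply: liftP].
- by rewrite fmap_comp -[LHS]ccompA left_adjoint_unit ccompA.
- by rewrite fmap_comp ccompA.
Qed.

End UniversalArrows.

(** * Isomorphisms, and uniqueness of the universal partial action *)

Section Isomorphisms.
Variable C : category.

Lemma iso_comp (a b c : C) (g : hom b c) (f : hom a b) :
  is_iso g -> is_iso f -> is_iso (g \oc f).
Proof.
move=> [g' [g'g gg']] [f' [f'f ff']]; exists (f' \oc g'); split.
  by rewrite ccompA -(ccompA f') g'g ccompf1.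
by rewrite ccompA -(ccompA g) ff' ccompf1.
Qed.

Definition iso_inv (a b : C) (f : hom a b) (fI : is_iso f) : hom b a :=
  projT1 (cid fI).

Lemma iso_invK (a b : C) (f : hom a b) (fI : is_iso f) :
  iso_inv fI \oc f = idc a.
Proof. by rewrite /iso_inv; case: cid => g []. Qed.

Lemma iso_invKr (a b : C) (f : hom a b) (fI : is_iso f) :
  f \oc iso_inv fI = idc b.
Proof. by rewrite /iso_inv; case: cid => g []. Qed.

Lemma iso_inv_iso (a b : C) (f : hom a b) (fI : is_iso f) : is_iso (iso_inv fI).
Proof. by exists f; rewrite iso_invK iso_invKr. Qed.

Lemma iso_inv_square (a b a' b' : C) (u : hom a b) (u' : hom a' b')
    (uI : is_iso u) (uI' : is_iso u') (f : hom a a') (g : hom b b') :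
  u' \oc f = g \oc u -> f \oc iso_inv uI = iso_inv uI' \oc g.
Proof.
move=> E; rewrite -[f]ccomp1f -(iso_invK uI') -[_ \oc f]ccompA E.
by rewrite !ccompA -[LHS]ccompA iso_invKr ccompf1.
Qed.

End Isomorphisms.

(** Lifting the inverse of each of [eta] and [eta'] gives a morphism each way; both composites are
    identities by uniqueness of lifts. *)
Lemma lifts_isomorphisms_unique (A : Grpd) (a b : PA)
    (eta : hom (Psi a) A) (eta' : hom (Psi b) A) :
  is_iso eta -> is_iso eta' ->
  lifts_isomorphisms eta -> lifts_isomorphisms eta' -> isomorphic a b.
Proof.
move=> etaI etaI' liftA liftB.
have [p [pE _]] := liftA b _ (iso_inv_iso etaI').
have [q [qE _]] := liftB a _ (iso_inv_iso etaI).
(* Both [r] and the identity lift the inverse of [e]. *)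
have endo c (e : hom (Psi c) A) (eI : is_iso e) (r : hom c c) :
    lifts_isomorphisms e -> fmap Psi r = iso_inv eI \oc e -> r = idc c.
  move=> /(_ c _ (iso_inv_iso eI))[s [_ sU]] /sU <-; apply: sU.
  by rewrite fmap_id iso_invK.
exists p, q; split; [apply: (endo _ _ etaI) => // | apply: (endo _ _ etaI') => //].
  by rewrite fmap_comp pE qE ccompA -(ccompA (iso_inv etaI)) iso_invKr ccompf1.
by rewrite fmap_comp pE qE ccompA -(ccompA (iso_inv etaI')) iso_invKr ccompf1.
Qed.

Theorem theorem2p8 :
  exists (Phi : functor Grpd PA)
    (eta : forall A : Grpd, hom (Psi (Phi A)) A),
    natural_isomorphism (comp_functor Psi Phi) (id_functor Grpd) eta /\
    (forall A : Grpd, lifts_isomorphisms (eta A)) /\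
    (forall (A : Grpd) (b : PA) (f : hom A (Psi b)) (phi : hom (Phi A) b),
       is_iso f -> fmap Psi phi = f \oc eta A -> is_iso (fmap Psi phi)) /\
    (forall (A : Grpd) (a : PA) (eta' : hom (Psi a) A),
       is_iso eta' -> lifts_isomorphisms eta' -> isomorphic a (Phi A)) /\
    adjoint Phi Psi.
Proof.
pose Phi := @left_adjoint Grpd PA Psi upa upa_unit upa_lift upa_liftP
  upa_lift_unique.
pose eta A : hom (Psi (Phi A)) A := iso_inv (upa_unit_iso A).
have etaI A : is_iso (eta A) by apply: iso_inv_iso.
have etaL A : lifts_isomorphisms (eta A).
  (* Since [eta A] inverts the unit, the required equation is equivalent to the one characterising
     [upa_lift f]. *)
  move=> b f _; exists (upa_lift f); split=> [|phi phiE].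
    rewrite -[in RHS](upa_liftP f) -(ccompA (fmap Psi (upa_lift f))).
    by rewrite (iso_invKr (upa_unit_iso A)) (ccompf1 (fmap Psi (upa_lift f))).
  apply/esym/upa_lift_unique.
  by rewrite phiE -(ccompA f) (iso_invK (upa_unit_iso A)) ccompf1.
exists Phi, eta; split.
  split=> // A B f; apply: iso_inv_square; apply: esym.
  exact: (@left_adjoint_unit Grpd PA Psi upa upa_unit upa_lift).
split=> //; split; first by move=> A b f phi fI ->; apply: iso_comp.
split; last exact: left_adjointP.
by move=> A a eta' etaI' liftA; apply: (lifts_isomorphisms_unique etaI').
Qed.
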